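(* Let $(\Omega,\psi)$ be a parameter space and $\mathcal F$ an increasing and discrete family of resonant sets, as described in the context, satisfying condition $[\sigma]$. Let $c>0$ with $c\ge d_*$, and let $l_c,u_c\ge 0$. [LB] If $\mu$ is a locally finite Borel measure on $\bar X$ satisfying conditions $[\mu>0]$ and $[\tau(c)]$, then $$\dim\big(\mathbf{Bad}(\mathcal F,2c+l_c)\big)\ \ge\ d_\mu\big(\mathbf{Bad}(\mathcal F,2c+l_c)\big)-\frac{|\log(\tau(c))|}{\sigma c}.$$ [UB] If condition $[N(c)]$ is satisfied, then for any formal ball $\omega=(x,\bar t_0)\in\Omega$, $$\dim\big(\mathbf{Bad}(\mathcal F,c)\cap\psi(\omega)\big)\ \le\ \frac{\log(N(c))}{\sigma(c+u_c)}.$$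
   Context: Setting. $(\bar X,d)$ is a proper metric space, $t_*\in\mathbb R\cup\{-\infty\}$, $\bar\Omega=\bar X\times(t_*,\infty)$ (its elements are called formal balls), and $\bar\psi:\bar\Omega\to\mathcal C(\bar X)$ is a map to the nonempty compact subsets of $\bar X$ that is monotonic: $\bar\psi(x,t+s)\subset\bar\psi(x,t)$ for all $s\ge0$. $X\subset\bar X$ is a nonempty closed subset, $\Omega=X\times(t_*,\infty)$ and $\psi(\omega)=\bar\psi(\omega)\cap X$ (a nonempty compact subset of $X$) for $\omega\in\Omega$. For $Y\subset\bar X$ and $t>t_*$ put $\mathcal N(Y,t)=\bigcup_{y\in Y}\bar\psi(y,t)$. A superscript $C$ denotes complement in $\bar X$. Family. $s_*>t_*$ is real and $\mathcal F=\{(R_n,s_n):n\in\mathbb N\}$ with $R_n\subset\bar X$, $s_n\ge s_*$, $R_n\subset R_{n+1}$, $s_n\le s_{n+1}$ (increasing), and $|\{n:s_n\le t\}|<\infty$ for all $t>s_1$ (discrete). For $t\ge s_1$, $\mathcal R(t)=\bigcup_{s_n\le t}R_n$. For $c\geq 0$, $\mathbf{Bad}(\mathcal F,c)=\{x\in X: x\notin\bigcup_{n\in\mathbb N}\mathcal N(R_n,s_n+c)\}$. $d_*\ge0$ is a fixed constant. For $k\in\mathbb N_0=\{0,1,2,\dots\}$ put $t_k=s_1+kc+l_c$, $L_k(c)=\bigcap_{i=1}^k\mathcal N(\mathcal R(t_i-l_c),t_i+c-d_* )^C$ (so $L_{-1}(c)=L_0(c)=\bar X$), and $\bar t_k=s_1+k(c+u_c)-u_c$,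 $U_k(c)=\bigcap_{s_n\le\bar t_k+u_c}\mathcal N(R_n,s_n+c)^C$, $U_{-1}(c)=X$. Conditions. $[\mu>0]$: $\mu(\psi(\omega))>0$ for all $\omega\in\Omega$. $[\tau(c)]$: there is a constant $\tau(c)>0$ such that for every $k\in\mathbb N_0$ and every $\omega=(x,t_k)\in\Omega$ with $x\in L_{k-1}(c)$ there is a collection of formal balls $\omega_i=(x_i,t_{k+1})\in\Omega$ with $x_i\in L_k(c)$, $\psi(\omega_i)\subset\psi(\omega)\setminus\mathcal N(\mathcal R(t_k-l_c),t_k+c)$, $\mu(\psi(\omega_i)\cap\psi(\omega_j))=0$ for $i\ne j$, and $\mu(\bigcup_i\psi(\omega_i))\ge\tau(c)\,\mu(\psi(\omega))$. $[N(c)]$: there is a constant $N(c)\ge0$ such that for every $k\in\mathbb N_0$ and every $\omega=(x,\bar t_k)\in\Omega$ with $x\in U_{k-1}(c)$ there is a collection of at most $N(c)$ formal balls $\omega_i=(x_i,\bar t_{k+1})\in\Omega$ with $x_i\in U_k(c)$ and $\psi(\omega)\setminus\bigcup_{s_n\le\bar t_k+u_c}\mathcal N(R_n,s_n+c)\subset\bigcup_i\psi(\omega_i)$. $[\sigma]$: there are constants $c_\sigma,\sigma>0$ with $\mathrm{diam}(\psi(x,t))\le c_\sigma e^{-\sigma t}$ for all $(x,t)\in\Omega$. $\dim$ is Hausdorff dimension (with $\dim\emptyset=-\infty$, $\log 0=-\infty$). The lower pointwise dimension of $\mu$ at $x\in\mathrm{supp}(\mu)$ is $d_\mu(x)=\liminf_{r\to0}\frac{\log\mu(B(x,r))}{\log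 r}$, and $d_\mu(Z)=\inf_{x\in Z\cap\mathrm{supp}(\mu)}d_\mu(x)$ for $Z\subset X$. *)

(* Defs.v *)
From HB Require Import structures.
From mathcomp Require Import all_boot all_order all_algebra.
From mathcomp Require Import all_classical all_reals all_analysis.

Set Implicit Arguments.
Unset Strict Implicit.
Unset Printing Implicit Defensive.

Import Order.TTheory GRing.Theory Num.Theory.
Import numFieldNormedType.Exports.

Local Open Scope classical_set_scope.
Local Open Scope ring_scope.

(* Metric spaces with a distinguished point. The point is never used below:
   it is there because measurable types are pointed in the library. *)
#[short(type="pmetricType")]
HB.structure Definition PMetric (R : numDomainType) :=
  { M of Metric R M & isPointed M }.

Section metric_notions.
Context {R : realType} {T : pmetricType R}.
Implicit Types (A U X : set T) (s delta : R).

Definition proper_metric (M : pmetricType R) : Prop :=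
  forall (x : M) (r : R), compact [set y | mdist x y <= r].

(* The element 0 only matters for the empty set, whose diameter is 0. *)
Definition diam A : \bar R :=
  ereal_sup (0%E |` [set (mdist x y)%:E | x in A & y in A]).

(* [diam U ^ s] with the usual conventions at [s = 0]: the empty set counts
   for 0 and a nonempty set for 1, including singletons (0 `^ 0 = 1). *)
Definition diam_pow s U : \bar R :=
  if U == set0 then 0%E else (diam U `^ s)%E.

(* Finite covers are included: they are completed by empty sets. *)
Definition hausdorff_premeasure s delta A : \bar R :=
  ereal_inf [set (\sum_(i <oo) diam_pow s (U i))%E | U in
    [set U : nat -> set T | A `<=` \bigcup_i U i /\
                            forall i, (diam (U i) <= delta%:E)%E]].

Definition hausdorff_measure s A : \bar R :=
  ereal_sup [set hausdorff_premeasure s delta A | delta in [set d | 0 < d]].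

Definition hausdorff_dim A : \bar R :=
  if A == set0 then -oo%E
  else ereal_inf [set s%:E | s in [set s | 0 <= s /\
                                          hausdorff_measure s A = 0%E]].

Definition borel (M : pmetricType R) := g_sigma_algebraType (@open M).

Definition locally_finite (mu : set (borel T) -> \bar R) : Prop :=
  forall x : T, exists U : set T, [/\ open U, U x & (mu U < +oo)%E].

Definition support (mu : set (borel T) -> \bar R) : set T :=
  [set x | forall U : set T, open U -> U x -> (0 < mu U)%E].

Definition lower_pointwise_dim (mu : set (borel T) -> \bar R) (x : T) : \bar R :=
  limf_einf (fun r : R => (lne (mu (ball x r)) / (ln r)%:E)%E) 0^'+.

Definition lower_dim_on (mu : set (borel T) -> \bar R) (Z : set T) : \bar R :=
  ereal_inf [set lower_pointwise_dim mu x | x in Z `&` support mu].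

End metric_notions.

Section parameter_space.
Context {R : realType} {Xbar : pmetricType R}.
Implicit Types (X Y : set Xbar) (tstar : \bar R) (psibar : Xbar * R -> set Xbar).

(* [formal_balls setT tstar] is $\bar\Omega$ and [formal_balls X tstar] is
   $\Omega$. Maps on $\bar\Omega$ are total functions on [Xbar * R]; nothing
   is assumed, nor used, about their values outside $\bar\Omega$. *)
Definition formal_balls X tstar : set (Xbar * R) :=
  [set w | X w.1 /\ (tstar < w.2%:E)%E].

Definition psi X psibar (w : Xbar * R) : set Xbar := psibar w `&` X.

Record is_parameter_space X tstar psibar : Prop := {
  ps_proper : proper_metric Xbar ;
  ps_tstar : tstar != +oo%E ;
  ps_psibar_neq0 : forall w, formal_balls setT tstar w -> psibar w !=set0 ;
  ps_psibar_compact : forall w, formal_balls setT tstar w -> compact (psibar w) ;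
  ps_psibar_monotonic : forall x t s, formal_balls setT tstar (x, t) ->
    0 <= s -> psibar (x, t + s) `<=` psibar (x, t) ;
  ps_X_neq0 : X !=set0 ;
  ps_X_closed : closed X ;
  ps_psi_neq0 : forall w, formal_balls X tstar w -> psi X psibar w !=set0
}.

Definition Nbhd psibar Y (t : R) : set Xbar := \bigcup_(y in Y) psibar (y, t).

End parameter_space.

Section resonant_family.
Context {R : realType} {Xbar : pmetricType R}.
Variables (X : set Xbar) (tstar : \bar R) (psibar : Xbar * R -> set Xbar).
(* Families are indexed from 0: [Res n] and [s n] are $R_{n+1}$ and $s_{n+1}$,
   so that [s 0] is $s_1$. *)
Variables (Res : nat -> set Xbar) (s : nat -> R).
Variables (dstar c l u : R).

Record is_resonant_family (sstar : R) : Prop := {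
  rf_sstar : (tstar < sstar%:E)%E ;
  rf_s_ge : forall n, sstar <= s n ;
  rf_Res_increasing : forall n, Res n `<=` Res n.+1 ;
  rf_s_increasing : forall n, s n <= s n.+1 ;
  rf_discrete : forall t, s 0%N < t -> finite_set [set n | s n <= t]
}.

Definition resonant_upto (t : R) : set Xbar :=
  \bigcup_(n in [set n | s n <= t]) Res n.

Definition Bad (a : R) : set Xbar :=
  [set x | X x /\ ~ (\bigcup_n Nbhd psibar (Res n) (s n + a)) x].

Definition tL (k : nat) : R := s 0%N + k%:R * c + l.

(* [L_k], for an integer [k >= -1]. *)
Definition Lset (k : int) : set Xbar :=
  \bigcap_(i in [set i : nat | (1 <= i)%N /\ i%:Z <= k])
    ~` Nbhd psibar (resonant_upto (tL i - l)) (tL i + c - dstar).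

Definition tU (k : nat) : R := s 0%N + k%:R * (c + u) - u.

(* [U_k], for an integer [k >= -1]. *)
Definition Uset (k : int) : set Xbar :=
  match k with
  | Posz k => \bigcap_(n in [set n | s n <= tU k + u])
                ~` Nbhd psibar (Res n) (s n + c)
  | Negz _ => X
  end.

Definition cond_mu_pos (mu : set (borel Xbar) -> \bar R) : Prop :=
  forall w, formal_balls X tstar w -> (0 < mu (psi X psibar w))%E.

(* The collection of formal balls $\omega_i = (x_i, t_{k+1})$ is given by the
   set [S] of the centres $x_i$. *)
Definition cond_tau (mu : set (borel Xbar) -> \bar R) (tau : R) : Prop :=
  0 < tau /\
  forall (k : nat) (x : Xbar),
    formal_balls X tstar (x, tL k) -> Lset (k%:Z - 1) x ->
    exists S : set Xbar,
      [/\ forall y, S y -> formal_balls X tstar (y, tL k.+1) /\ Lset k%:Z y,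
          forall y, S y -> psi X psibar (y, tL k.+1) `<=`
            psi X psibar (x, tL k) `\`
              Nbhd psibar (resonant_upto (tL k - l)) (tL k + c),
          forall y z, S y -> S z -> y <> z ->
            mu (psi X psibar (y, tL k.+1) `&` psi X psibar (z, tL k.+1)) = 0%E &
          (tau%:E * mu (psi X psibar (x, tL k)) <=
            mu (\bigcup_(y in S) psi X psibar (y, tL k.+1)))%E].

(* The collection is given by the list [S] of its centres. *)
Definition cond_N (N : R) : Prop :=
  0 <= N /\
  forall (k : nat) (x : Xbar),
    formal_balls X tstar (x, tU k) -> Uset (k%:Z - 1) x ->
    exists S : seq Xbar,
      [/\ (size S)%:R <= N,
          forall y, y \in S ->
            formal_balls X tstar (y, tU k.+1) /\ Uset k%:Z y &
          psi X psibar (x, tU k) `\`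
            \bigcup_(n in [set n | s n <= tU k + u]) Nbhd psibar (Res n) (s n + c)
          `<=` \bigcup_(y in [set` S]) psi X psibar (y, tU k.+1)].

Definition cond_sigma (csigma sigma : R) : Prop :=
  [/\ 0 < csigma, 0 < sigma &
      forall x t, formal_balls X tstar (x, t) ->
        (diam (psi X psibar (x, t)) <= (csigma * expR (- (sigma * t)))%:E)%E].

End resonant_family.

(* Main.v *)
Require Import Defs.
From HB Require Import structures.
From mathcomp Require Import all_boot all_order all_algebra.
From mathcomp Require Import all_classical all_reals all_analysis.
From mathcomp Require Import finmap ring lra.

(* Upper bound: iterating the covering condition [k] times covers the set by
   [N ^ k] pieces of diameter [O(exp (- k * sigma * (c + u)))].

   Lower bound: for [tau' < tau], condition [tau] gives a finitely branching
   tree of formal balls whose limit set lies in the bad set. Giving each node a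
   weight shared among its children in proportion to their [mu]-mass, a node of
   level [k] weighs at most [tau' ^ (- k)] times its mass. A ball of radius
   [rho], of the order of the diameters at level [k], only meets level-[k]
   pieces inside the ball of radius [2 * rho], so its weight is at most
   [tau' ^ (- k) * mu (ball z (2 * rho))], that is
   [O (rho ^ (d - ln tau' / (- sigma * c)))] as soon as [d < d_mu]. Frostman's
   argument, made uniform in [z] by splitting the limit set into countably many
   pieces, concludes; then [tau'] tends to [tau]. *)

Set Implicit Arguments.
Unset Strict Implicit.
Unset Printing Implicit Defensive.

Import Order.TTheory GRing.Theory Num.Theory.
Import numFieldNormedType.Exports.

Local Open Scope classical_set_scope.
Local Open Scope ring_scope.

(** * Metric facts and geometric covers *)

Section metric_facts.
Context {R : realType} {T : pmetricType R}.
Implicit Types (A U : set T) (s : R).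

Lemma metric_ball_open (x : T) (r : R) : open (ball x r).
Proof.
rewrite openE => y; rewrite ballEmdist /= => xy.
apply/nbhs_ballP; exists (r - mdist x y) => /=; first by rewrite subr_gt0.
move=> z; rewrite !ballEmdist /= => yz.
by rewrite (le_lt_trans (metric_triangle _ y _))// -ltrBrDl.
Qed.

Lemma open_borel A : open A -> measurable (A : set (borel T)).
Proof. by move=> oA; exact: sub_sigma_algebra. Qed.

Lemma compact_borel A : compact A -> measurable (A : set (borel T)).
Proof.
move=> /(compact_closed (@metric_hausdorff _ _)) cA.
rewrite -(setCK A); apply: measurableC; apply: open_borel.
by rewrite openC.
Qed.

Lemma diam_ge0 A : (0 <= diam A)%E.
Proof. by apply: ereal_sup_ubound; left. Qed.

Lemma diam_set0 : diam (set0 : set T) = 0%E.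
Proof.
apply/eqP; rewrite eq_le diam_ge0 andbT; by apply: ge_ereal_sup => w [->//|[x []]].
Qed.

Lemma mdist_le_diam A x y : A x -> A y -> ((mdist x y)%:E <= diam A)%E.
Proof. by move=> Ax Ay; apply: ereal_sup_ubound; right; exists x => //; exists y. Qed.

Lemma diam_pow_ge0 s A : (0 <= diam_pow s A)%E.
Proof. by rewrite /diam_pow; case: ifP => // _; exact: poweR_ge0. Qed.

Lemma diam_pow0 s : diam_pow s (set0 : set T) = 0%E.
Proof. by rewrite /diam_pow eqxx. Qed.

Lemma diam_pow_le s A (r : R) :
  0 <= s -> (diam A <= r%:E)%E -> (diam_pow s A <= (r `^ s)%:E)%E.
Proof.
move=> s0 Ar; rewrite /diam_pow; case: ifP => _; first by rewrite lee_fin powR_ge0.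
rewrite -poweR_EFin gt0_ler_poweR// in_itv/= ?diam_ge0 ?leey//.
by rewrite andbT (le_trans (diam_ge0 A)).
Qed.

(** The cover of level [k] costs at most [C ^ s * (N * q ^ s) ^ k], which tends to 0 together with
    the diameters. *)
Lemma hausdorff_measure_geometric_covers A (N C q s : R) :
  0 <= C -> 0 < q < 1 -> 0 < s -> N * q `^ s < 1 ->
  (forall k : nat, exists n (U : nat -> set T),
    [/\ n%:R <= N ^+ k, A `<=` \bigcup_(i < n) U i &
        forall i, (i < n)%N -> (diam (U i) <= (C * q ^+ k)%:E)%E]) ->
  hausdorff_measure s A = 0%E.
Proof.
move=> C0 /andP[q0 q1] s0 Nq cov.
have N0 : 0 <= N.
  by have [n [U [+ _ _]]] := cov 1%N; rewrite expr1; apply: le_trans; rewrite ler0n.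
apply/eqP; rewrite eq_le; apply/andP; split; last first.
  apply: (@le_trans _ _ (hausdorff_premeasure s 1 A)); last first.
    by apply: ereal_sup_ubound; exists 1 => //=; rewrite ltr01.
  by apply: le_ereal_inf_tmp => _ [U _ <-]; apply: nneseries_ge0 => *; exact: diam_pow_ge0.
apply: ge_ereal_sup => _ [delta /= delta0 <-].
apply/lee_addgt0Pr => e e0; rewrite add0e.
set p := N * q `^ s in Nq.
have p0 : 0 <= p by rewrite mulr_ge0// powR_ge0.
have cvgq : (fun k => C * q ^+ k) @ \oo --> C * 0.
  by apply: cvgMr; apply: cvg_expr; rewrite ger0_norm// ltW.
have cvgp : (fun k => C `^ s * p ^+ k) @ \oo --> C `^ s * 0.
  by apply: cvgMr; apply: cvg_expr; rewrite ger0_norm.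
rewrite mulr0 in cvgq; rewrite mulr0 in cvgp.
have [k [kd ke]] : exists k, C * q ^+ k < delta /\ C `^ s * p ^+ k < e.
  near \oo => k; exists k; split.
    by near: k; apply: (cvgr_lt 0).
  by near: k; apply: (cvgr_lt 0).
have [n [U [nN AU dU]]] := cov k.
pose V i := if (i < n)%N then U i else set0.
apply: (@le_trans _ _ (\sum_(i <oo) diam_pow s (V i))%E).
  apply: ereal_inf_lbound; exists V => //; split.
    by move=> x /AU[i /= i_n Uix]; exists i => //; rewrite /V i_n.
  move=> i; rewrite /V; case: ifPn => [i_n|_].
    by rewrite (le_trans (dU i i_n))// lee_fin ltW.
  by rewrite diam_set0 lee_fin ltW.
rewrite (nneseries_split 0 n); last by move=> *; exact: diam_pow_ge0.
rewrite add0n [X in (_ + X)%E]eseries0; last first.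
  by move=> i /=; rewrite /V ltnNge => -> _; exact: diam_pow0.
rewrite adde0 big_mkord.
apply: (@le_trans _ _ (\sum_(i < n) ((C * q ^+ k) `^ s)%:E)%E).
  apply: lee_sum => i _; rewrite /V ltn_ord.
  by apply: diam_pow_le; [exact: ltW|exact: dU].
rewrite sumEFin lee_fin sumr_const card_ord -mulr_natl.
apply: (le_trans _ (ltW ke)).
rewrite powRM ?(exprn_ge0 _ (ltW q0))// mulrCA ler_wpM2l ?powR_ge0//.
have -> : (q ^+ k) `^ s = (q `^ s) ^+ k.
  by rewrite -!powR_mulrn ?powR_ge0 ?(ltW q0)// -!powRrM mulrC.
by rewrite /p exprMn ler_wpM2r// exprn_ge0// powR_ge0.
Unshelve. all: by end_near.
Qed.

(** The exponent [s = ln N / - ln q + e] gives [N * q ^ s = q ^ e < 1] for every [e > 0]; [1 <= N]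
    keeps [s] nonnegative. *)
Lemma hausdorff_dim_geometric_covers A (N C q : R) :
  1 <= N -> 0 <= C -> 0 < q < 1 ->
  (forall k : nat, exists n (U : nat -> set T),
    [/\ n%:R <= N ^+ k, A `<=` \bigcup_(i < n) U i &
        forall i, (i < n)%N -> (diam (U i) <= (C * q ^+ k)%:E)%E]) ->
  (hausdorff_dim A <= (ln N / - ln q)%:E)%E.
Proof.
move=> N1 C0 q01 cov; have /andP[q0 q1] := q01.
have lnq : 0 < - ln q by rewrite oppr_gt0 ln_lt0// q0.
have lnN : 0 <= ln N / - ln q by rewrite divr_ge0 ?ln_ge0// ltW.
rewrite /hausdorff_dim; case: ifP => [_|_]; first by rewrite leNye.
apply/lee_addgt0Pr => e e0; rewrite -EFinD.
apply: ereal_inf_lbound; exists (ln N / - ln q + e) => //; split.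
  by rewrite addr_ge0// ltW.
apply: (hausdorff_measure_geometric_covers C0 q01 _ _ cov).
  by rewrite ltr_wpDl.
have N0 : 0 < N by rewrite (lt_le_trans _ N1).
rewrite -(lnK N0) /powR gt_eqF// -expRD expR_lt1.
rewrite mulrDl invrN mulrN mulNr divfK ?lt_eqF//; last by rewrite -oppr_gt0.
by rewrite addrA lnK ?posrE// subrr add0r pmulr_rlt0// -oppr_gt0.
Qed.

End metric_facts.

(** * Frostman's lemma *)

Section mass_distribution.
Context {R : realType} {T : pmetricType R}.
Implicit Types (A U : set T) (s : R).

Lemma hausdorff_dim_ltP A (D : R) : 0 < D -> (hausdorff_dim A < D%:E)%E ->
  exists s, [/\ 0 <= s, s < D & hausdorff_measure s A = 0%E].
Proof.
move=> D0; rewrite /hausdorff_dim; case: ifPn => [/eqP -> _|_].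
  (* The dimension of the empty set is [-oo] by convention, not an infimum of exponents; 0 serves,
     since empty sets cover at no cost. *)
  exists 0; split => //; apply/eqP; rewrite eq_le; apply/andP; split.
    apply: ge_ereal_sup => _ [delta /= delta0 <-].
    apply: ereal_inf_lbound; exists (fun=> set0); first split => //.
      by move=> _; rewrite diam_set0 lee_fin ltW.
    by apply: eseries0 => *; exact: diam_pow0.
  apply: (@le_trans _ _ (hausdorff_premeasure 0 1 (set0 : set T))); last first.
    by apply: ereal_sup_ubound; exists 1 => //=; rewrite ltr01.
  by apply: le_ereal_inf_tmp => _ [U _ <-]; apply: nneseries_ge0 => *; exact: diam_pow_ge0.
move=> /ereal_inf_lt[_ [s [s0 Hs] <-]] sD.
by exists s; split.
Qed.

(** A cover adapted to Frostman's argument: [rho i] is positive and strictly exceeds all distances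
    within [U i], so a ball of radius [rho i] around any point of [U i] contains [U i]. *)
Lemma small_cover A (D : R) : 0 < D -> (hausdorff_dim A < D%:E)%E ->
  forall delta e : R, 0 < delta -> 0 < e ->
  exists (U : nat -> set T) (rho : nat -> R),
  [/\ A `<=` \bigcup_i U i, forall i, 0 < rho i <= delta,
      forall i x y, U i x -> U i y -> mdist x y < rho i &
      forall n, \sum_(i < n) rho i `^ D <= e].
Proof.
move=> D0 /(hausdorff_dim_ltP D0)[s [s0 sD Hs]] delta e delta0 e0.
(* The bound 1 lets the exponent grow from [s] to [D] without increasing powers of positive
   diameters; [delta / 2] leaves room for doubling the sizes. *)
pose del := Num.min (delta / 2) 1.
have del0 : 0 < del by rewrite lt_min ltr01 divr_gt0.
have del1 : del <= 1 by rewrite ge_min lexx orbT.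
have deld : del <= delta / 2 by rewrite ge_min lexx.
(* The factor [2 ^ D] pays for the doubling; the last halving splits the sum between the diameters
   and the floors [eta]. *)
pose e' := e / 2 `^ D / 2.
have e'0 : 0 < e' by rewrite !divr_gt0// powR_gt0.
have : (hausdorff_premeasure s del A < e'%:E)%E.
  apply: (@le_lt_trans _ _ 0%E); last by rewrite lte_fin.
  by rewrite -Hs; apply: ereal_sup_ubound; exists del.
move=> /ereal_inf_lt[_ [U [AU dU] <-]] Ue'.
(* Positive floors for the sizes, needed when a diameter vanishes; their [D]-th powers sum to at
   most [e']. *)
pose eta i := Num.min del ((e' / 2 ^+ i.+1) `^ D^-1).
have pos i : 0 < e' / 2 ^+ i.+1 by rewrite divr_gt0// exprn_gt0.
have eta0 i : 0 < eta i by rewrite lt_min del0 powR_gt0.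
have etaD i : eta i `^ D <= e' / 2 ^+ i.+1.
  apply: (@le_trans _ _ (((e' / 2 ^+ i.+1) `^ D^-1) `^ D)).
    by rewrite ge0_ler_powR ?nnegrE ?powR_ge0 ?(ltW D0) ?(ltW (eta0 i))// ge_min lexx orbT.
  by rewrite -powRrM mulVf ?gt_eqF// powRr1// ltW.
have fd i : diam (U i) \is a fin_num.
  by rewrite ge0_fin_numE ?diam_ge0// (le_lt_trans (dU i))// ltry.
have dE i : diam (U i) = (fine (diam (U i)))%:E by rewrite fineK.
pose d i := fine (diam (U i)).
have d0 i : 0 <= d i by rewrite fine_ge0// diam_ge0.
have ddel i : d i <= del by rewrite -lee_fin -dE dU.
have dD i : ((d i `^ D)%:E <= diam_pow s (U i))%E.
  rewrite /diam_pow; case: ifPn => [/eqP Ui|_].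
    by rewrite /d Ui diam_set0/= powR0// gt_eqF.
  rewrite dE poweR_EFin lee_fin -/(d i).
  have [->|di0] := eqVneq (d i) 0; first by rewrite powR0 ?gt_eqF// powR_ge0.
  apply: ger_powR; last exact: ltW.
  by rewrite lt_neqAle eq_sym di0 d0/= (le_trans (ddel i)).
pose m i := Num.max (d i) (eta i).
have m0 i : 0 < m i by rewrite lt_max eta0 orbT.
exists U, (fun i => 2 * m i); split => //.
- move=> i; rewrite mulr_gt0//= mulrC -ler_pdivlMr//.
  by rewrite ge_max !(le_trans _ deld)// ge_min lexx.
- move=> i x y Ux Uy; apply: (@le_lt_trans _ _ (m i)).
    by rewrite le_max -lee_fin -dE mdist_le_diam.
  by rewrite ltr_pMl// ltr1n.
- move=> n.
  have mD i : m i `^ D <= d i `^ D + e' / 2 ^+ i.+1.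
    rewrite /m; have [_|_] := leP (d i) (eta i).
      by rewrite (le_trans (etaD i))// lerDr powR_ge0.
    by rewrite lerDl ltW.
  have S1 : \sum_(i < n) d i `^ D <= e'.
    rewrite -lee_fin -sumEFin (le_trans _ (ltW Ue'))//.
    apply: (@le_trans _ _ (\sum_(i < n) diam_pow s (U i))%E).
      by apply: lee_sum => i _; exact: dD.
    rewrite -(big_mkord xpredT (fun i => diam_pow s (U i))).
    by apply: nneseries_lim_ge => *; exact: diam_pow_ge0.
  have S2 : \sum_(i < n) (e' / 2 ^+ i.+1) <= e'.
    rewrite -mulr_sumr ler_piMr ?(ltW e'0)//.
    have -> : \sum_(i < n) (2 ^+ i.+1)^-1 = 1 - (2 ^+ n)^-1 :> R.
      elim: n {S1} => [|n IH]; first by rewrite big_ord0 expr0 invr1 subrr.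
      by rewrite big_ord_recr /= IH exprS invfM; set x := (_ ^+ n)^-1; lra.
    by rewrite gerBl invr_ge0 exprn_ge0.
  have -> : \sum_(i < n) (2 * m i) `^ D = 2 `^ D * \sum_(i < n) m i `^ D.
    by rewrite mulr_sumr; apply: eq_bigr => i _; rewrite powRM// ltW.
  rewrite mulrC -ler_pdivlMr ?powR_gt0//.
  have -> : e / 2 `^ D = e' + e' by rewrite -splitr.
  by rewrite (le_trans _ (lerD S1 S2))// -big_split ler_sum//= => i _.
Qed.

(* Frostman's lemma for a decreasing sequence [nu k] of finitely subadditive
   contents, in place of a measure: by compactness of [K 0], the finite
   subadditivity on [K k] for large [k] is all that is used. *)
Lemma frostman (K : nat -> set T) (nu : nat -> set T -> R) (D : R) A :
  0 < D ->
  compact (K 0%N) -> (forall k, closed (K k)) -> (forall k, K k.+1 `<=` K k) ->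
  (forall k, nu k set0 = 0) ->
  (forall k V, nu k.+1 V <= nu k V) ->
  (forall k (L : seq (set T)),
    K k `<=` \bigcup_(V in [set` L]) V -> 1 <= \sum_(V <- L) nu k V) ->
  (forall z, (\bigcap_k K k) z -> exists (C r0 : R), 0 < r0 /\
    forall rho, 0 < rho < r0 -> exists k, nu k (ball z rho) <= C * rho `^ D) ->
  \bigcap_k K k `<=` A ->
  (D%:E <= hausdorff_dim A)%E.
Proof.
move=> D0 cK0 clK Kdec nu0 nudec nuS nuball KA.
rewrite leNgt; apply/negP => dimA.
(* On [Am m] the single number [m.+1] serves as constant and as inverse scale, uniformly in the
   centre. *)
pose Am (m : nat) := [set z | (\bigcap_k K k) z /\
  forall rho, 0 < rho <= m.+1%:R^-1 ->
    exists k, nu k (ball z rho) <= m.+1%:R * rho `^ D].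
(* Against the constant [m.+1], the pieces of index [m] cost at most [2 ^ - (m + 2)], and these
   numbers sum to less than 1/2. *)
pose eps (m : nat) : R := (2 ^+ m.+2)^-1 / m.+1%:R.
have eps0 m : 0 < eps m by rewrite divr_gt0// invr_gt0 exprn_gt0.
have /choice[f Hf] : forall m : nat, exists Ur : (nat -> set T) * (nat -> R),
  [/\ A `<=` \bigcup_i Ur.1 i, forall i, 0 < Ur.2 i <= m.+1%:R^-1,
      forall i x y, Ur.1 i x -> Ur.1 i y -> mdist x y < Ur.2 i &
      forall n, \sum_(i < n) Ur.2 i `^ D <= eps m].
  move=> m; have [||U [rho H]] := @small_cover A D D0 dimA m.+1%:R^-1 (eps m) => //.
  by exists (U, rho).
(* A piece that meets [Am m] lies in a ball centred at a common point, where the content bound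
   holds; otherwise the empty set suffices. *)
have /choice[g Hg] : forall p : nat * nat, exists Vk : set T * nat,
  [/\ open Vk.1, (f p.1).1 p.2 `&` Am p.1 `<=` Vk.1 &
      nu Vk.2 Vk.1 <= p.1.+1%:R * (f p.1).2 p.2 `^ D].
  move=> [m i] /=; have [_ rho0 dU _] := Hf m.
  have [[z [Uz Az]]|/set0P/negP/negPn/eqP UA0] := pselect ((f m).1 i `&` Am m !=set0).
    have [Kz /(_ _ (rho0 i))[k nuk]] := Az.
    exists (ball z ((f m).2 i), k); split => //=; first exact: metric_ball_open.
    by move=> y [Uy _]; rewrite ballEmdist /=; exact: dU.
  exists (set0, 0%N); split => //=; [exact: open0|by rewrite UA0|].
  by rewrite nu0 mulr_ge0// powR_ge0.
(* The complements of the [K n] take care of the points outside the limit set, which gives an open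
   cover of the whole compact set [K 0]. *)
pose h (j : (nat * nat) + nat) :=
  match j with inl p => (g p).1 | inr n => ~` K n end.
have : finite_subset_cover setT h (K 0%N).
  have := cK0; rewrite compact_cover; apply.
    move=> [p|n] _ /=; first by have [] := Hg p.
    by rewrite openC.
  move=> z K0z; have [Kz|] := pselect ((\bigcap_k K k) z); last first.
    by move=> /existsNP[n /not_implyP[_ nK]]; exists (inr n).
  have [C [r0 [r0_gt0 HC]]] := nuball z Kz.
  (* An integer above [x] dominates both [C] and the inverse of [r0], which places [z] in some
     [Am m]. *)
  pose x := `|C| + r0^-1.
  have x0 : 0 <= x by rewrite addr_ge0// invr_ge0 ltW.
  pose m := Num.bound x.
  have xm : x <= m.+1%:R by rewrite (le_trans (ltW (archi_boundP x0)))// ler_nat.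
  have Cm : C <= m.+1%:R.
    by rewrite (le_trans (ler_norm C))// (le_trans _ xm)// lerDl invr_ge0 ltW.
  have rm : m.+1%:R^-1 < r0.
    rewrite invf_plt ?posrE// (lt_le_trans _ (_ : m.+1%:R <= _))//.
    rewrite (le_lt_trans _ (_ : m%:R < _)) ?ltr_nat//.
    have := archi_boundP x0; rewrite -/m => /ltW; apply: le_trans.
    by rewrite lerDr.
  have Az : Am m z.
    split=> // rho /andP[rho0 rhom].
    have [|k Hk] := HC rho; first by rewrite rho0 (le_lt_trans rhom).
    by exists k; rewrite (le_trans Hk)// ler_wpM2r// powR_ge0.
  have [AU _ _ _] := Hf m.
  have [i _ Uz] := AU z (KA z Kz).
  by exists (inl (m, i)) => //=; have [_ + _] := Hg (m, i); apply; split.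
move=> [J _ KJ].
pose w (j : (nat * nat) + nat) :=
  match j with inl p => maxn p.1.+1 p.2.+1 | inr n => n end.
pose n1 := (\max_(j <- J) w j)%N.
pose P := [seq (m, i) | m <- iota 0 n1, i <- iota 0 n1].
(* [K n2] misses every complement selected in [J], and at level [n2] each ball indexed by [P] has
   content at most that of its own level. *)
pose n2 := (n1 + \max_(p <- P) (g p).2)%N.
have Kmono k n : (k <= n)%N -> K n `<=` K k.
  move=> /subnK <-; elim: (n - k)%N => // a IH.
  by rewrite addSn; apply: subset_trans IH.
have numono k n V : (k <= n)%N -> nu n V <= nu k V.
  move=> /subnK <-; elim: (n - k)%N => // a IH.
  by rewrite addSn; apply: le_trans IH.
have : 1 <= \sum_(V <- [seq (g p).1 | p <- P]) nu n2 V.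
  apply: nuS => z Kz.
  have [j Jj hj] := KJ z (Kmono _ _ (leq0n _) _ Kz).
  have wj : (w j <= n1)%N by rewrite /n1; apply: leq_bigmax_seq.
  case: j Jj hj wj => [[m i]|n] Jj /= hj wj.
    exists (g (m, i)).1 => //=; apply: map_f.
    by move: wj; rewrite geq_max => /andP[? ?]; apply: allpairs_f; rewrite mem_iota.
  by case: hj; apply: (Kmono n n2) => //; rewrite (leq_trans wj)// leq_addr.
apply/negP; rewrite -ltNge big_map.
apply: (@le_lt_trans _ _ (\sum_(p <- P) p.1.+1%:R * (f p.1).2 p.2 `^ D)).
  rewrite big_seq [leRHS]big_seq; apply: ler_sum => p Pp.
  have [_ _] := Hg p; apply: le_trans; apply: numono.
  by rewrite (leq_trans _ (leq_addl _ _))//; exact: (@leq_bigmax_seq _ P xpredT (fun p => (g p).2) p Pp isT).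
have iotaE F : \sum_(i <- iota 0 n1) F i = \sum_(i < n1) F i :> R.
  by rewrite -(big_mkord xpredT F) /index_iota subn0.
rewrite big_allpairs /=.
apply: (@le_lt_trans _ _ (\sum_(m < n1) (2 ^+ m.+2)^-1)).
  rewrite iotaE; apply: ler_sum => m _; rewrite -mulr_sumr iotaE.
  have [_ _ _ /(_ n1)] := Hf m.
  by rewrite mulrC /eps ler_pdivlMr.
have -> : \sum_(m < n1) (2 ^+ m.+2)^-1 = 2^-1 - (2 ^+ n1.+1)^-1 :> R.
  elim: n1 {P n2 iotaE} => [|n IH]; first by rewrite big_ord0 expr1 subrr.
  by rewrite big_ord_recr /= IH (exprS _ n.+1) invfM; set x := (_ ^+ n.+1)^-1; lra.
have : 0 < (2 ^+ n1.+1)^-1 :> R by rewrite invr_gt0 exprn_gt0.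
by set x := (_ ^+ _)^-1; lra.
Qed.
End mass_distribution.

(** * Essentially disjoint families *)

Section essentially_disjoint.
Local Open Scope ereal_scope.
Context d (T : measurableType d) (R : realType).
Variable mu : {measure set T -> \bar R}.

(** By induction: removing the first set from [P] and from the other sets costs its mass in [P], and
    changes the other masses by 0. *)
Lemma sum_essentially_disjoint_le (I : eqType) (L : seq I) (F : I -> set T) P :
  uniq L -> (forall i, i \in L -> measurable (F i)) -> measurable P ->
  (forall i, i \in L -> F i `<=` P) ->
  (forall i j, i \in L -> j \in L -> i != j -> mu (F i `&` F j) = 0) ->
  \sum_(i <- L) mu (F i) <= mu P.
Proof.
elim: L F P => [|i L IH] F P; first by rewrite big_nil.
rewrite cons_uniq => /andP[iL uL] mF mP FP F0; rewrite big_cons.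
have mFi : measurable (F i) by apply: mF; rewrite mem_head.
have inL j : j \in L -> j \in i :: L by rewrite inE orbC => ->.
have -> : mu P = mu (F i) + mu (P `\` F i).
  rewrite (measureDI mu mP mFi) addeC; congr (mu _ + _).
  by rewrite setIC setIidl//; apply: FP; rewrite mem_head.
rewrite leeD2l// (_ : \sum_(j <- L) _ = \sum_(j <- L) mu (F j `\` F i)).
  apply: IH => //.
  - by move=> j jL; apply: measurableD => //; apply: mF; exact: inL.
  - exact: measurableD.
  - by move=> j jL; apply: setSD; apply: FP; exact: inL.
  - move=> j k jL kL jk.
    apply: (@subset_measure0 _ _ _ mu _ (F j `&` F k)).
    + by apply: measurableI; apply: measurableD => //; apply: mF; exact: inL.
    + by apply: measurableI; apply: mF; exact: inL.
    + by apply: setISS; exact: subDsetl.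
    + by apply: F0 => //; exact: inL.
rewrite big_seq [RHS]big_seq; apply: eq_bigr => j jL.
transitivity (mu (F j `\` F i) + mu (F j `&` F i)).
  by apply: measureDI => //; apply: mF; exact: inL.
rewrite F0 ?adde0 ?mem_head ?inL//.
by apply: contraNneq iL => <-.
Qed.

(** Only finitely many sets can have mass at least [1 / (n + 1)] inside a set of finite mass, and
    positive masses exceed one of these thresholds. *)
Lemma essentially_disjoint_countable (I : choiceType) (S : set I) (F : I -> set T) P :
  (forall i, S i -> measurable (F i)) -> measurable P -> mu P < +oo ->
  (forall i, S i -> F i `<=` P) -> (forall i, S i -> 0 < mu (F i)) ->
  (forall i j, S i -> S j -> i <> j -> mu (F i `&` F j) = 0) ->
  countable S.
Proof.
move=> mF mP Poo FP F0 Fd.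
pose A n := [set i | S i /\ n.+1%:R^-1%:E <= mu (F i)].
have -> : S = \bigcup_n A n.
  apply/seteqP; split => [i Si|i [n _ []]//].
  have Fi0 := F0 i Si; have : exists2 r : R, (0 < r)%R & r%:E <= mu (F i).
    move: Fi0; case: (mu (F i)) => [r| |]// r0; first by exists r.
    by exists 1%R => //; rewrite leey.
  move=> [r r0 rF]; exists (Num.bound r^-1) => //; split => //.
  rewrite (le_trans _ rF)// lee_fin invf_ple ?posrE//.
  have r'0 : (0 <= r^-1)%R by rewrite invr_ge0 ltW.
  by rewrite (le_trans (ltW (archi_boundP r'0)))// ler_nat.
apply: bigcup_countable => // n _; apply: finite_set_countable.
apply: contrapT => infA.
have Pfin : mu P \is a fin_num by rewrite ge0_fin_numE.
pose N := Num.bound (fine (mu P) * n.+1%:R).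
have [B BA NB] := infinite_set_fset N infA.
have BS i : i \in enum_fset B -> S i by move=> iB; have [] := BA i iB.
have : N%:R%:E * n.+1%:R^-1%:E <= mu P.
  apply: (@le_trans _ _ (\sum_(i <- enum_fset B) mu (F i))); last first.
    apply: sum_essentially_disjoint_le => //.
    - by move=> i /BS; exact: mF.
    - by move=> i /BS; exact: FP.
    - by move=> i j /BS Si /BS Sj /eqP; exact: Fd.
  apply: (@le_trans _ _ (\sum_(i <- enum_fset B) n.+1%:R^-1%:E)).
    rewrite sumEFin big_const_seq count_predT iter_addr_0 -[X in _ <= X%:E]mulr_natl -EFinM lee_fin.
    by rewrite ler_wpM2r// ?invr_ge0// ler_nat.
  by rewrite big_seq [leRHS]big_seq; apply: lee_sum => i /BA[].
apply/negP; rewrite -ltNge -(fineK Pfin) -EFinM lte_fin ltr_pdivlMr//.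
by apply: archi_boundP; rewrite mulr_ge0// fine_ge0.
Qed.

(** Countability turns the union into a sequence; by sigma-subadditivity some partial sum of masses
    already exceeds [a]. *)
Lemma essentially_disjoint_truncation (I : choiceType) (S : set I)
    (F : I -> set T) P (a : \bar R) :
  (forall i, S i -> measurable (F i)) -> measurable P -> mu P < +oo ->
  (forall i, S i -> F i `<=` P) -> (forall i, S i -> 0 < mu (F i)) ->
  (forall i j, S i -> S j -> i <> j -> mu (F i `&` F j) = 0) ->
  a < mu (\bigcup_(i in S) F i) ->
  exists L : seq I, [/\ uniq L, forall i, i \in L -> S i & a <= \sum_(i <- L) mu (F i)].
Proof.
move=> mF mP Poo FP F0 Fd aS.
have /countable_injP[f finj] := essentially_disjoint_countable mF mP Poo FP F0 Fd.
(* [G n] is the member of the family numbered [n] by the injection [f], or the empty set when [n] is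
   not a number in use. *)
pose G n := \bigcup_(i in S `&` f @^-1` [set n]) F i.
have GF i : S i -> G (f i) = F i.
  move=> Si; apply/seteqP; split => [x [j [Sj fji] Fx]|x Fx]; last by exists i.
  by rewrite -(finj j i) //; apply/mem_set.
have GE n : G n = set0 \/ exists2 i, S i & f i = n.
  have [[i [Si fi]]|nS] := pselect (exists i, S i /\ f i = n).
    by right; exists i.
  left; rewrite -subset0 => x [i [Si /= fi]] _; by apply: nS; exists i.
have mG n : measurable (G n).
  by have [->//|[i Si <-]] := GE n; rewrite GF//; exact: mF.
have UE : \bigcup_(i in S) F i = \bigcup_n G n.
  apply/seteqP; split => [x [i Si Fx]|x [n _ [i [Si _] Fx]]]; last by exists i.
  by exists (f i) => //; rewrite GF.
have [n an] : exists n, a < \sum_(k < n) mu (G k).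
  apply: contrapT => /forallNP nan.
  move: aS; apply/negP; rewrite -leNgt UE.
  apply: (@le_trans _ _ (\sum_(k <oo) mu (G k))).
    by apply: measure_sigma_subadditive => //; exact: bigcupT_measurable.
  apply: lime_le; first by apply: is_cvg_nneseries.
  by near=> n; rewrite big_mkord leNgt; apply/negP/nan.
have [L [uL LS _ sumL]] : exists L : seq I,
  [/\ uniq L, forall i, i \in L -> S i, forall i, i \in L -> (f i < n)%N &
      \sum_(k < n) mu (G k) <= \sum_(i <- L) mu (F i)].
  elim: n {an} => [|n [L [uL LS Ln sumL]]].
    by exists [::]; split => //; rewrite big_ord0 big_nil.
  have [G0|[i Si fi]] := GE n.
    exists L; split => // [j /Ln jn|]; first by rewrite ltnS ltnW.
    by rewrite big_ord_recr /= G0 measure0 adde0.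
  exists (i :: L); split => //=.
  - by rewrite uL andbT; apply/negP => /Ln; rewrite fi ltnn.
  - by move=> j; rewrite inE => /predU1P[->//|/LS].
  - by move=> j; rewrite inE => /predU1P[->|/Ln /ltnW]; rewrite ?fi.
  - by rewrite big_ord_recr big_cons /= addeC -fi GF// leeD2l// fi.
by exists L; split => //; rewrite (le_trans (ltW an)).
Unshelve. all: by end_near.
Qed.

End essentially_disjoint.

(** * Trees of sets and their weights *)

Section measure_tree.
Context {R : realType} {T : pmetricType R}.
Implicit Types (mu : {measure set (borel T) -> \bar R}) (tau C q : R).

Lemma locally_finite_compact mu (A : set T) :
  locally_finite mu -> compact A -> (mu A < +oo)%E.
Proof.
move=> /choice[U HU] cA.
have [J _ AJ] : finite_subset_cover setT U A.
  have := cA; rewrite compact_cover; apply; first by move=> x _; have [] := HU x.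
  by move=> x Ax; exists x => //; have [] := HU x.
have mU x : measurable (U x : set (borel T)) by apply: open_borel; have [] := HU x.
apply: (@le_lt_trans _ _ (\sum_(x \in [set` J]) mu (U x))%E).
  by apply: content_sub_fsum => //; exact: compact_borel.
rewrite fsbig_finite//= set_fsetK.
by apply: lte_sum_pinfty => x _; have [] := HU x.
Qed.

(** A node of level [k] is a centre [x] with [valid k x], and its children form a finite list.
    Essential disjointness is recorded by its consequence in each open set [B], which localizes
    masses to balls. *)
Record is_measure_tree mu (valid : nat -> T -> Prop) (Psi : nat -> T -> set T)
    (ch : nat -> T -> seq T) tau C q : Prop := {
  mt_valid : forall k x y, valid k x -> y \in ch k x -> valid k.+1 y ;
  mt_sub : forall k x y, valid k x -> y \in ch k x -> Psi k.+1 y `<=` Psi k x ;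
  mt_compact : forall k x, valid k x -> compact (Psi k x) ;
  mt_gt0 : forall k x, valid k x -> (0 < mu (Psi k x))%E ;
  mt_lty : forall k x, valid k x -> (mu (Psi k x) < +oo)%E ;
  mt_diam : forall k x, valid k x -> (diam (Psi k x) <= (C * q ^+ k)%:E)%E ;
  mt_disjoint : forall k x (B : set T), valid k x -> open B ->
    (\sum_(y <- ch k x) mu (Psi k.+1 y `&` B) <= mu (Psi k x `&` B))%E ;
  mt_mass : forall k x, valid k x ->
    (tau%:E * mu (Psi k x) <= \sum_(y <- ch k x) mu (Psi k.+1 y))%E
}.

(** * Weights of the nodes, the contents they induce, and the dimension of the limit set *)

Section weights.
Variables (mu : {measure set (borel T) -> \bar R}).
Variables (valid : nat -> T -> Prop) (Psi : nat -> T -> set T).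
Variables (ch : nat -> T -> seq T) (tau C q : R) (x0 : T).
Hypothesis tree : is_measure_tree mu valid Psi ch tau C q.
Hypothesis tau0 : 0 < tau.
Hypothesis q01 : 0 < q < 1.
Hypothesis C0 : 0 < C.
Hypothesis valid0 : valid 0 x0.

Let M k x : R := fine (mu (Psi k x)).
Let total k x : R := \sum_(y <- ch k x) M k.+1 y.

(* A node is a pair [(w, x)] of a weight and a centre; the weight of a parent
   is shared among its children in proportion to their [mu]-mass. *)
Fixpoint tree_level k : seq (R * T) :=
  match k with
  | 0%N => [:: (1, x0)]
  | k'.+1 => [seq (p.1 * M k'.+1 y / total k' p.2, y)
                | p <- tree_level k', y <- ch k' p.2]
  end.

Definition tree_set k : set T := \bigcup_(p in [set` tree_level k]) Psi k p.2.

(** A node counts in full as soon as its piece meets [V], which gives subadditivity for arbitrary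
    sets at the price of additivity. *)
Definition tree_content k (V : set T) : R :=
  \sum_(p <- tree_level k) if `[< Psi k p.2 `&` V !=set0 >] then p.1 else 0.

Let MP k x : valid k x -> mu (Psi k x) = (M k x)%:E.
Proof.
move=> vx; rewrite fineK// ge0_fin_numE//; exact: (mt_lty tree).
Qed.

Let M0 k x : valid k x -> 0 < M k x.
Proof. by move=> vx; rewrite -lte_fin -MP//; exact: (mt_gt0 tree). Qed.

Let total_ge k x : valid k x -> tau * M k x <= total k x.
Proof.
move=> vx; rewrite -lee_fin EFinM -MP//.
rewrite (le_trans (mt_mass tree vx))// -sumEFin big_seq [leRHS]big_seq.
by apply: lee_sum => y /(mt_valid tree vx) vy; rewrite MP.
Qed.

Let total_gt0 k x : valid k x -> 0 < total k x.
Proof. by move=> vx; rewrite (lt_le_trans _ (total_ge vx))// mulr_gt0// M0. Qed.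

(** From parent to child the ratio of weight to mass is multiplied by the parent's mass over the
    children's total mass, at most [tau^-1]. *)
Lemma tree_levelP k p : p \in tree_level k ->
  [/\ valid k p.2, 0 <= p.1 & p.1 <= (tau ^+ k * M 0 x0)^-1 * M k p.2].
Proof.
elim: k p => [|k IH] p /=.
  rewrite inE => /eqP -> /=; rewrite expr0 mul1r mulVf ?gt_eqF ?M0//.
move=> /allpairsPdep[p' [y [/IH[vp w0 wp] yp ->]]] /=.
have vy := mt_valid tree vp yp.
have Tp := total_gt0 vp; have My := M0 vy; have Mp := M0 vp.
split => //; first by rewrite divr_ge0 ?mulr_ge0 ?(ltW My) ?(ltW Tp).
rewrite ler_pdivrMr// exprSr -mulrA [tau * _]mulrC mulrA invfM.
set A := (_ * _)^-1 in wp *.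
have A0 : 0 <= A by rewrite invr_ge0 mulr_ge0 ?exprn_ge0 ?(ltW tau0) ?(ltW (M0 valid0)).
rewrite (le_trans (ler_wpM2r (ltW My) wp))//.
have -> : A * M k p'.2 * M k.+1 y = A / tau * M k.+1 y * (tau * M k p'.2).
  by field; rewrite gt_eqF.
by rewrite ler_wpM2l ?total_ge// mulr_ge0 ?divr_ge0// ltW.
Qed.

Let levelV k p : p \in tree_level k -> valid k p.2.
Proof. by move=> /tree_levelP[]. Qed.

Lemma tree_content0 k : tree_content k set0 = 0.
Proof.
rewrite /tree_content big1// => p _; rewrite setI0.
by case: asboolP => // -[].
Qed.

(** Children share exactly the weight of their parent, and a parent whose piece misses [V] has no
    child meeting it. *)
Lemma tree_content_decr k V : tree_content k.+1 V <= tree_content k V.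
Proof.
rewrite /tree_content /= big_allpairs_dep big_seq [leRHS]big_seq.
apply: ler_sum => p pk; have vp := levelV pk; have [_ p0 _] := tree_levelP pk.
have Tp := total_gt0 vp.
have wy y : y \in ch k p.2 -> 0 <= p.1 * M k.+1 y / total k p.2.
  move=> /(mt_valid tree vp) vy.
  by rewrite divr_ge0 ?mulr_ge0 ?(ltW (M0 vy))// ltW.
case: asboolP => [_|nV].
  apply: (@le_trans _ _ (\sum_(y <- ch k p.2) p.1 * M k.+1 y / total k p.2)).
    rewrite big_seq [leRHS]big_seq; apply: ler_sum => y /wy.
    by case: ifP.
  by rewrite -mulr_suml -mulr_sumr mulfK// gt_eqF.
rewrite big_seq big1// => y yp; case: asboolP => // -[z [Pz Vz]].
by case: nV; exists z; split => //; exact: (mt_sub tree vp yp).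
Qed.

Lemma tree_content_total k : \sum_(p <- tree_level k) p.1 = 1.
Proof.
elim: k => [|k IH] /=; first by rewrite big_seq1.
rewrite big_allpairs_dep -IH big_seq [RHS]big_seq; apply: eq_bigr => p /levelV vp.
by rewrite /= -mulr_suml -mulr_sumr mulfK// gt_eqF// total_gt0.
Qed.

(** Pieces have positive mass, hence are nonempty: each meets some covering set, so its weight is
    counted at least once. *)
Lemma tree_content_cover k (L : seq (set T)) :
  tree_set k `<=` \bigcup_(V in [set` L]) V -> 1 <= \sum_(V <- L) tree_content k V.
Proof.
move=> KL; rewrite exchange_big /= -(tree_content_total k).
rewrite big_seq [leRHS]big_seq; apply: ler_sum => p pk.
have [vp p0 _] := tree_levelP pk.
have [z Pz] : Psi k p.2 !=set0.
  apply/set0P/negP => /eqP P0.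
  by have := mt_gt0 tree vp; rewrite P0 measure0 ltxx.
have [V /= VL Vz] : (\bigcup_(V in [set` L]) V) z by apply: KL; exists p.
rewrite (big_rem V)//= asboolT; last by exists z.
by rewrite lerDl sumr_ge0// => W _; case: ifP.
Qed.

Lemma tree_set_compact k : compact (tree_set k).
Proof.
rewrite /tree_set bigcup_seq big_seq; apply: bigsetU_compact => p /levelV vp.
exact: (mt_compact tree).
Qed.

Lemma tree_set_decr k : tree_set k.+1 `<=` tree_set k.
Proof.
move=> z [_ /allpairsPdep[p [y [pk yp ->]]] /= Pz].
by exists p => //; apply: (mt_sub tree (levelV pk) yp).
Qed.

Lemma tree_level_sum_le k (B : set T) : open B ->
  (\sum_(p <- tree_level k) mu (Psi k p.2 `&` B) <= mu B)%E.
Proof.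
move=> oB; elim: k => [|k IH].
  rewrite big_seq1 /=; apply: measureIr; last exact: open_borel.
  exact: (compact_borel (mt_compact tree valid0)).
rewrite (le_trans _ IH)// big_allpairs_dep big_seq [leRHS]big_seq.
by apply: lee_sum => p /levelV vp; exact: (mt_disjoint tree).
Qed.

(** A counted piece lies in the doubled ball; [tree_levelP] trades its weight for mass, and
    [tree_level_sum_le] adds up these masses inside that ball. *)
Lemma tree_content_ball k z rho : C * q ^+ k <= rho ->
  ((tree_content k (ball z rho))%:E <=
     ((tau ^+ k * M 0 x0)^-1)%:E * mu (ball z (2 * rho)))%E.
Proof.
move=> qrho; set c := _^-1.
have c0 : 0 <= c by rewrite invr_ge0 mulr_ge0 ?exprn_ge0 ?(ltW tau0) ?(ltW (M0 valid0)).
have oB := @metric_ball_open R T z (2 * rho).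
apply: (@le_trans _ _ (c%:E *
    \sum_(p <- tree_level k) mu (Psi k p.2 `&` ball z (2 * rho)))%E); last first.
  by rewrite lee_wpmul2l ?lee_fin// tree_level_sum_le.
rewrite ge0_sume_distrr// /tree_content -sumEFin big_seq [leRHS]big_seq.
apply: lee_sum => p pk; have [vp p0 pc] := tree_levelP pk.
case: asboolP => [[y [Py]]|_]; last by rewrite mule_ge0.
rewrite ballEmdist /= => zy.
rewrite (_ : _ `&` _ = Psi k p.2) ?MP ?lee_fin//.
apply: setIidl => x Px; rewrite ballEmdist /=.
rewrite (le_lt_trans (metric_triangle _ y _))// mulr2n mulrDl mul1r ltr_leD//.
rewrite (le_trans _ qrho)// -lee_fin (le_trans _ (mt_diam tree vp))//.
exact: mdist_le_diam.
Qed.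

(** The children keep at least the fraction [tau] of the root's mass but cannot exceed it. This
    makes the exponent [ln tau / ln q] nonnegative. *)
Lemma tree_tau_le1 : tau <= 1.
Proof.
rewrite -(ler_pM2r (M0 valid0)) mul1r -lee_fin EFinM -MP//.
have := mt_disjoint tree valid0 openT; rewrite setIT; apply: le_trans.
rewrite (le_trans (mt_mass tree valid0))//.
by rewrite le_eqVlt; apply/orP; left; apply/eqP; apply: eq_bigr => y _; rewrite setIT.
Qed.

Lemma tree_setSP k z : tree_set k.+1 z ->
  exists x y, [/\ valid k x, y \in ch k x & Psi k.+1 y z].
Proof.
by move=> [_ /allpairsPdep[p [y [/levelV vp yp ->]]] Pz]; exists p.2, y.
Qed.

Let expq_lt (e : R) : 0 < e -> exists k, C * q ^+ k < e.
Proof.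
move=> e0; have /andP[q0 q1] := q01.
have cvgq : (fun k => C * q ^+ k) @ \oo --> C * 0.
  by apply: cvgMr; apply: cvg_expr; rewrite ger0_norm// ltW.
rewrite mulr0 in cvgq.
near \oo => k; exists k.
by near: k; apply: (cvgr_lt 0).
Unshelve. all: by end_near.
Qed.

(** Diameters tend to 0, so a neighbourhood of a limit point contains a whole piece, of positive
    mass. *)
Lemma tree_set_support : \bigcap_k tree_set k `<=` Defs.support mu.
Proof.
move=> z Kz U oU Uz.
have [r /= r0 rU] : exists2 r : R, 0 < r & ball z r `<=` U.
  by apply/nbhs_ballP; exact: open_nbhs_nbhs.
have [k qk] := expq_lt r0.
have [p /levelV vp Pz] := Kz k I.
rewrite (lt_le_trans (mt_gt0 tree vp))//.
have mP : measurable (Psi k p.2 : set (borel T)).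
  exact: (compact_borel (mt_compact tree vp)).
have mU : measurable (U : set (borel T)) by exact: open_borel.
rewrite -(setIidl (_ : Psi k p.2 `<=` U)); first exact: measureIr.
move=> y Py; apply: rU; rewrite ballEmdist /= -lte_fin.
rewrite (le_lt_trans (mdist_le_diam Pz Py))//.
by rewrite (le_lt_trans (mt_diam tree vp))// lte_fin.
Qed.

Lemma tree_dimension (A : set T) (dim : R) :
  ln tau / ln q < dim -> \bigcap_k tree_set k `<=` A ->
  (forall z, (\bigcap_k tree_set k) z -> exists r0 : R, 0 < r0 /\
     forall r, 0 < r < r0 -> (mu (ball z r) <= (r `^ dim)%:E)%E) ->
  ((dim - ln tau / ln q)%:E <= hausdorff_dim A)%E.
Proof.
move=> dimgt KA ball_le; have tau1 := tree_tau_le1; have /andP[q0 q1] := q01.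
have lnq : ln q < 0 by rewrite ln_lt0.
set a := ln tau / ln q in dimgt *.
have a0 : 0 <= a by rewrite /a -mulrNN -invrN divr_ge0 ?oppr_ge0 ?ln_le0 ?(ltW q1).
(* This identity converts the factor [tau ^ - k] of the weights into a power of the scale
   [q ^ k]. *)
have qa : q `^ a = tau.
  by rewrite /powR gt_eqF// /a divfK ?lt_eqF// lnK.
apply: (@frostman _ _ tree_set tree_content _ _ _ (@tree_set_compact 0) _
  (@tree_set_decr) (@tree_content0) (@tree_content_decr) (@tree_content_cover)) => //.
- by rewrite subr_gt0.
- move=> k; apply: compact_closed; first exact: metric_hausdorff.
  exact: tree_set_compact.
move=> z /ball_le[r0 [r0_gt0 Hr0]].
(* [2 ^ dim] comes from the doubled radius and [(C / q) ^ a] from rounding [rho] to a level. The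
   bound [C] forces a positive level, and [r0 / 2] keeps [2 * rho] below [r0]. *)
exists ((M 0 x0)^-1 * (C / q) `^ a * 2 `^ dim), (Num.min C (r0 / 2)).
split; first by rewrite lt_min C0 divr_gt0.
move=> rho; rewrite lt_min => /and3P[rho0 rhoC rhor].
have : exists k, C * q ^+ k <= rho.
  by have [k /ltW] := expq_lt rho0; exists k.
(* The least such level is comparable to [rho]: minimality gives [rho <= C * q ^+ k.-1]. *)
move=> /ex_minnP[k qk kmin]; exists k.
rewrite -lee_fin (le_trans (tree_content_ball z qk))//.
have k0 : (0 < k)%N.
  by rewrite lt0n; apply: contraTneq qk => ->; rewrite expr0 mulr1 -ltNge.
have qk1 : rho <= C * q ^+ k.-1.
  by rewrite leNgt; apply/negP => /ltW/kmin; rewrite -ltnS prednK// ltnn.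
have ball2 := Hr0 (2 * rho).
apply: (@le_trans _ _ (((tau ^+ k * M 0 x0)^-1)%:E * ((2 * rho) `^ dim)%:E)%E).
  rewrite lee_wpmul2l ?lee_fin ?invr_ge0 ?mulr_ge0 ?exprn_ge0 ?(ltW tau0) ?(ltW (M0 valid0))//.
  by apply: ball2; rewrite mulr_gt0//= mulrC -ltr_pdivlMr.
rewrite -EFinM lee_fin (@powRM _ 2 rho) ?(ltW rho0)// invfM mulrC.
have -> : rho `^ (dim - a) = rho `^ dim * (rho `^ a)^-1.
  by rewrite powRB//; apply/implyP => _; rewrite gt_eqF.
have tauk : (tau ^+ k)^-1 <= (C / q) `^ a * (rho `^ a)^-1.
  rewrite ler_pdivlMr ?powR_gt0// ler_pdivrMl ?exprn_gt0//.
  have -> : tau ^+ k = (q ^+ k) `^ a.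
    by rewrite -qa -!powR_mulrn ?powR_ge0 ?(ltW q0)// -!powRrM mulrC.
  rewrite -powRM ?exprn_ge0 ?divr_ge0 ?(ltW q0) ?(ltW C0)//.
  rewrite ge0_ler_powR ?nnegrE ?(ltW rho0)//.
    by rewrite mulr_ge0 ?exprn_ge0 ?divr_ge0 ?(ltW q0) ?(ltW C0).
  rewrite (le_trans qk1)// -[in leRHS](prednK k0) exprS le_eqVlt; apply/orP; left.
  by apply/eqP; field; rewrite gt_eqF.
have -> : 2 `^ dim * rho `^ dim * ((tau ^+ k)^-1 * (M 0 x0)^-1) =
  (M 0 x0)^-1 * 2 `^ dim * rho `^ dim * (tau ^+ k)^-1 by ring.
have -> : (M 0 x0)^-1 * (C / q) `^ a * 2 `^ dim * (rho `^ dim * (rho `^ a)^-1) =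
  (M 0 x0)^-1 * 2 `^ dim * rho `^ dim * ((C / q) `^ a * (rho `^ a)^-1) by ring.
by rewrite ler_wpM2l// !mulr_ge0 ?powR_ge0// invr_ge0 ltW// M0.
Unshelve. all: by end_near.
Qed.

End weights.
End measure_tree.

(** * The two bounds *)

Lemma ereal_between (R : realType) (x y : \bar R) :
  (x < y)%E -> exists r : R, (x < r%:E < y)%E.
Proof.
case: x y => [x| |] [y| |] //; rewrite ?lte_fin.
- move=> xy; exists ((x + y) / 2); rewrite !lte_fin; apply/andP; split; lra.
- by move=> _; exists (x + 1); rewrite ltry lte_fin ltrDl ltr01.
- by move=> _; exists (y - 1); rewrite ltNyr lte_fin gtrBl ltr01.
- by move=> _; exists 0; rewrite ltry ltNyr.
Qed.

(** For [r < 1] the denominator [ln r] is negative, so clearing it reverses the inequality into an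
    upper bound on the mass. *)
Lemma lower_pointwise_dim_gt (R : realType) (T : pmetricType R)
    (mu : {measure set (borel T) -> \bar R}) (z : T) (dim : R) :
  (dim%:E < lower_pointwise_dim mu z)%E ->
  exists r0 : R, 0 < r0 /\
    forall r, 0 < r < r0 -> (mu (ball z r) <= (r `^ dim)%:E)%E.
Proof.
rewrite /lower_pointwise_dim limf_einfE => /ereal_sup_gt[_ [V V0 <-] dimV].
have /nbhs_ballP[e /= e0 eV] : nbhs (0 : R) [set x | 0 < x -> V x] by [].
exists (Num.min e 1); split; first by rewrite lt_min e0 ltr01.
move=> r /andP[r0]; rewrite lt_min => /andP[re r1].
have Vr : V r.
  apply: eV => //=; rewrite /ball /= sub0r normrN gtr0_norm//.
have lnr : ln r < 0 by rewrite ln_lt0// r0.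
have : (dim%:E < lne (mu (ball z r)) / (ln r)%:E)%E.
  by rewrite (lt_le_trans dimV)//; apply: ereal_inf_lbound; exists r.
rewrite inver lt_eqF// lte_ndivlMr//.
rewrite -EFinM; case: (mu (ball z r)) => [m| |] //=; last by rewrite leNye.
rewrite lee_fin; case: ifPn => [m0 _|]; first by rewrite (le_trans m0)// powR_ge0.
rewrite -ltNge lte_fin => m0 mlt.
by rewrite /powR gt_eqF// -(lnK m0) ler_expR ltW.
Qed.

(** * Upper bound: iterated covers of the bad set *)

Section upper_bound.
Context {R : realType} {Xbar : pmetricType R}.
Variables (X : set Xbar) (tstar : \bar R) (psibar : Xbar * R -> set Xbar).
Variables (Res : nat -> set Xbar) (s : nat -> R).
Variables (csigma sigma c u N : R).
Hypothesis sig : cond_sigma X tstar psibar csigma sigma.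
Hypothesis cN : cond_N X tstar psibar Res s c u N.

(** Bad points avoid every neighbourhood removed in [cond_N], so they remain covered at each step
    while the number of balls grows by a factor at most [N]. *)
Lemma Bad_cover x k : formal_balls X tstar (x, tU s c u 0) ->
  exists L : seq Xbar, [/\ (size L)%:R <= N ^+ k,
    forall y, y \in L -> formal_balls X tstar (y, tU s c u k) /\
      Uset X psibar Res s c u (k%:Z - 1) y &
    Bad X psibar Res s c `&` psi X psibar (x, tU s c u 0) `<=`
      \bigcup_(y in [set` L]) psi X psibar (y, tU s c u k)].
Proof.
move=> fx; elim: k => [|k [L [sL Lf Lcov]]].
  exists [:: x]; split; first by rewrite expr0.
    by move=> y; rewrite inE => /eqP ->; split => //; have [] := fx.
  by move=> z [_ zx]; exists x => //=; rewrite inE.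
have [N0 HN] := cN.
have /choice[S HS] : forall y, exists S : seq Xbar, y \in L ->
    [/\ (size S)%:R <= N,
          forall z, z \in S ->
            formal_balls X tstar (z, tU s c u k.+1) /\ Uset X psibar Res s c u k%:Z z &
          psi X psibar (y, tU s c u k) `\`
            \bigcup_(n in [set n | s n <= tU s c u k + u]) Nbhd psibar (Res n) (s n + c)
          `<=` \bigcup_(z in [set` S]) psi X psibar (z, tU s c u k.+1)].
  move=> y; have [yL|yL] := boolP (y \in L); last by exists [::].
  by have [fy Uy] := Lf y yL; have [S HS] := HN k y fy Uy; exists S.
exists (flatten [seq S y | y <- L]); split.
- rewrite size_flatten sumnE big_map big_map natr_sum exprSr.
  apply: (@le_trans _ _ (\sum_(y <- L) N)).
    by rewrite big_seq [leRHS]big_seq; apply: ler_sum => y /HS[].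
  by rewrite big_const_seq count_predT iter_addr_0 -[leLHS]mulr_natl ler_wpM2r.
- move=> z /flatten_mapP[y yL zS]; have [_ /(_ z zS) + _] := HS y yL.
  by rewrite -addn1 PoszD addrK.
- move=> z Az; have [y /= yL zy] := Lcov z Az.
  have [_ _ /(_ z)[]] := HS y yL.
    split => // -[n _ zn]; have [[_ nz] _] := Az.
    by apply: nz; exists n.
  by move=> w /= wS zw; exists w => //=; apply/flatten_mapP; exists y.
Qed.

Lemma hausdorff_dim_Bad_le x : 0 < c -> 0 <= u -> 
  formal_balls X tstar (x, tU s c u 0) ->
  (hausdorff_dim (Bad X psibar Res s c `&` psi X psibar (x, tU s c u 0))
   <= lne N%:E / (sigma * (c + u))%:E)%E.
Proof.
move=> c0 u0 fx; have [csigma0 sigma0 diam_le] := sig.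
have [A0|/set0P[z Az]] := eqVneq
  (Bad X psibar Res s c `&` psi X psibar (x, tU s c u 0)) set0.
  by rewrite /hausdorff_dim A0 eqxx leNye.
(* A nonempty set needs at least one ball at level 1, which rules out a negative [ln N]. *)
have N1 : 1 <= N.
  have [L [sL _ /(_ z Az)[y /= yL _]]] := Bad_cover 1 fx.
  by rewrite expr1 in sL; rewrite (le_trans _ sL)// ler1n; case: (L) yL.
have cu : 0 < c + u by rewrite ltr_wpDr.
have scu : 0 < sigma * (c + u) by rewrite mulr_gt0.
rewrite lne_EFin ?(lt_le_trans _ N1)// inver gt_eqF// -EFinM.
(* The denominator becomes [- ln q], where [q = expR (- (sigma * (c + u)))] is the ratio of the
   diameter bounds at consecutive levels. *)
rewrite -[sigma * _]opprK -[X in - X]expRK.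
apply: (@hausdorff_dim_geometric_covers _ _ _ _ (csigma * expR (- (sigma * tU s c u 0)))) => //.
- by rewrite mulr_ge0 ?expR_ge0// ltW.
- by rewrite expR_gt0 expR_lt1 oppr_lt0.
move=> k; have [L [sL fL Lcov]] := Bad_cover k fx.
exists (size L), (fun i => psi X psibar (nth x L i, tU s c u k)); split => //.
  move=> w /Lcov[y /= yL wy]; exists (index y L); first by rewrite /= index_mem.
  by rewrite nth_index.
move=> i iL; have [fi _] := fL _ (mem_nth x iL).
rewrite (le_trans (diam_le _ _ fi))// lee_fin -mulrA -expRM_natl -expRD.
rewrite ler_wpM2l ?(ltW csigma0)// ler_expR /tU.
by rewrite le_eqVlt; apply/orP; left; apply/eqP; ring.
Qed.

End upper_bound.

(** * Lower bound: a tree of formal balls avoiding the resonant sets *)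

Section lower_bound.
Context {R : realType} {Xbar : pmetricType R}.
Variables (X : set Xbar) (tstar : \bar R) (psibar : Xbar * R -> set Xbar).
Variables (Res : nat -> set Xbar) (s : nat -> R).
Variables (sstar dstar csigma sigma c l : R).
Hypothesis ps : is_parameter_space X tstar psibar.
Hypothesis rf : is_resonant_family tstar Res s sstar.
Hypothesis sig : cond_sigma X tstar psibar csigma sigma.
Hypotheses (c0 : 0 < c) (l0 : 0 <= l).
Variables (mu : {measure set (borel Xbar) -> \bar R}) (tau : R).
Hypothesis mulf : locally_finite mu.
Hypothesis mu_pos : cond_mu_pos X tstar psibar mu.
Hypothesis ctau : cond_tau X tstar psibar Res s dstar c l mu tau.

Let valid k x := formal_balls X tstar (x, tL s c l k) /\
  Lset psibar Res s dstar c l (k%:Z - 1) x.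
Let Psi k x := psi X psibar (x, tL s c l k).
Let hole k := Nbhd psibar (resonant_upto Res s (tL s c l k - l)) (tL s c l k + c).

Lemma psi_compact w : formal_balls X tstar w -> compact (psi X psibar w).
Proof.
move=> [Xw tw]; apply: compact_closedI; last exact: (ps_X_closed ps).
by apply: (ps_psibar_compact ps).
Qed.

Let Psi_borel k x : valid k x -> measurable (Psi k x : set (borel Xbar)).
Proof. by move=> [fx _]; apply: compact_borel; exact: psi_compact. Qed.

Let Psi_lty k x : valid k x -> (mu (Psi k x) < +oo)%E.
Proof. by move=> [fx _]; apply: locally_finite_compact => //; exact: psi_compact. Qed.

Let Psi_gt0 k x : valid k x -> (0 < mu (Psi k x))%E.
Proof. by move=> [fx _]; exact: mu_pos. Qed.

(** The collection given by [cond_tau] may be infinite; since the parent's mass is positive and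
    finite, lowering [tau] to [tau'] leaves room to keep finitely many children. *)
Lemma children_truncation tau' k x : tau' < tau -> valid k x ->
  exists L : seq Xbar, [/\ uniq L,
    forall y, y \in L -> valid k.+1 y /\ Psi k.+1 y `<=` Psi k x `\` hole k,
    forall y z, y \in L -> z \in L -> y <> z ->
      mu (Psi k.+1 y `&` Psi k.+1 z) = 0%E &
    (tau'%:E * mu (Psi k x) <= \sum_(y <- L) mu (Psi k.+1 y))%E].
Proof.
move=> tau'tau vx; have [_ /(_ k x)] := ctau; case: (vx) => fx Lx.
move=> /(_ fx Lx)[S [Sv Ssub Sd Smass]].
have vS y : S y -> valid k.+1 y.
  by move=> /Sv[fy Ly]; split => //; rewrite -addn1 PoszD addrK.
have [L [uL LS massL]] : exists L : seq Xbar,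
  [/\ uniq L, forall y, y \in L -> S y &
   (tau'%:E * mu (Psi k x) <= \sum_(y <- L) mu (Psi k.+1 y))%E].
  apply: (@essentially_disjoint_truncation _ (borel Xbar) _ mu Xbar S (Psi k.+1) (Psi k x)) => //.
  - by move=> y Sy; apply: Psi_borel; exact: vS.
  - exact: Psi_borel.
  - exact: Psi_lty.
  - by move=> y /Ssub sub z /sub[].
  - by move=> y Sy; apply: Psi_gt0; exact: vS.
  - apply: lt_le_trans Smass.
    have := Psi_gt0 vx; have := Psi_lty vx; rewrite -/(Psi k x).
    case: (mu (Psi k x)) => [m| |]// _; rewrite lte_fin => m0.
    by rewrite -!EFinM lte_fin ltr_pM2r.
exists L; split => //.
- by move=> y /LS Sy; split; [exact: vS|exact: Ssub].
- by move=> y z /LS Sy /LS Sz; exact: Sd.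
Qed.

Lemma resonant_tree tau' : 0 < tau' -> tau' < tau ->
  exists ch : nat -> Xbar -> seq Xbar,
  is_measure_tree mu valid Psi ch tau'
    (csigma * expR (- (sigma * tL s c l 0))) (expR (- (sigma * c))) /\
  forall k x y, valid k x -> y \in ch k x -> Psi k.+1 y `<=` ~` hole k.
Proof.
move=> tau'0 tau'tau.
(* Children are chosen for all pairs at once, with the empty list as default at invalid nodes. *)
have /choice[ch Hch] : forall p : nat * Xbar, exists L : seq Xbar, valid p.1 p.2 ->
  [/\ uniq L,
    forall y, y \in L -> valid p.1.+1 y /\ Psi p.1.+1 y `<=` Psi p.1 p.2 `\` hole p.1,
    forall y z, y \in L -> z \in L -> y <> z ->
      mu (Psi p.1.+1 y `&` Psi p.1.+1 z) = 0%E &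
    (tau'%:E * mu (Psi p.1 p.2) <= \sum_(y <- L) mu (Psi p.1.+1 y))%E].
  move=> [k x] /=; have [vx|nvx] := pselect (valid k x); last by exists [::].
  by have [L HL] := children_truncation tau'tau vx; exists L.
exists (fun k x => ch (k, x)); split; last first.
  move=> k x y vx yx z zy; have [_ /(_ y yx)[_ sub] _ _] := Hch (k, x) vx.
  by have [] := sub z zy.
split => //.
- by move=> k x y vx yx; have [_ /(_ y yx)[]] := Hch (k, x) vx.
- move=> k x y vx yx z zy; have [_ /(_ y yx)[_ sub] _ _] := Hch (k, x) vx.
  by have [] := sub z zy.
- by move=> k x [fx _]; exact: psi_compact.
- move=> k x [fx _]; have [csigma0 sigma0 diam_le] := sig.
  rewrite (le_trans (diam_le _ _ fx))// lee_fin -mulrA -expRM_natl -expRD.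
  rewrite ler_wpM2l ?(ltW csigma0)// ler_expR /tL.
  by rewrite le_eqVlt; apply/orP; left; apply/eqP; ring.
- move=> k x B vx oB; have [uL sub disj _] := Hch (k, x) vx.
  have mB : measurable (B : set (borel Xbar)) by exact: open_borel.
  have mL y : y \in ch (k, x) -> measurable (Psi k.+1 y : set (borel Xbar)).
    by move=> /sub[vy _]; exact: Psi_borel.
  have mPx := Psi_borel vx.
  apply: (@sum_essentially_disjoint_le _ (borel Xbar) _ mu _ _
    (fun y => Psi k.+1 y `&` B)) => //.
  + by move=> y /mL mPy; exact: measurableI.
  + exact: measurableI.
  + by move=> y /sub[_ suby]; apply: setSI => z /suby[].
  + move=> y z yL zL /eqP yz.
    apply: (@subset_measure0 _ _ _ mu _ (Psi k.+1 y `&` Psi k.+1 z)).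
    * by apply: measurableI; apply: measurableI => //; exact: mL.
    * by apply: measurableI; exact: mL.
    * by apply: setISS; exact: subIsetl.
    * exact: disj.
- by move=> k x vx; have [] := Hch (k, x) vx.
Qed.

(* [s n] lies in some window [(s 0 + (k - 1) c, s 0 + k c]], and avoiding the
   [k]-th hole then keeps a point out of the [n]-th resonant set. *)
Lemma avoid_holes_Bad z : X z -> (forall k, ~ hole k z) ->
  Bad X psibar Res s (2 * c + l) z.
Proof.
move=> Xz hz; split => // -[n _ [y Ry zy]].
have sn0 : 0 <= s n - s 0%N.
  rewrite subr_ge0; elim: (n) => // m; move=> /le_trans; apply.
  exact: (rf_s_increasing rf).
have : exists k : nat, s n - s 0%N <= k%:R * c.
  exists (Num.bound ((s n - s 0%N) / c)); rewrite -ler_pdivrMr//.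
  by apply/ltW/archi_boundP; rewrite divr_ge0// ltW.
move=> /ex_minnP[k sk kmin].
have kc : k%:R * c <= s n - s 0%N + c.
  case: k sk kmin => [|k] _ kmin; first by rewrite mul0r addr_ge0// ltW.
  rewrite leNgt; apply/negP => lt.
  have /kmin : s n - s 0%N <= k%:R * c by move: lt; rewrite -natr1 mulrDl mul1r; lra.
  by rewrite ltnn.
apply: (hz k); exists y; first by exists n => //=; rewrite /tL; lra.
(* The window costs up to one [c] and the hole adds [c + l], whence [2 * c + l]; the nonnegative
   remainder is absorbed by monotonicity of [psibar]. *)
have e : s n + (2 * c + l) = tL s c l k + c + (s n - s 0%N + c - k%:R * c).
  by rewrite /tL; ring.
rewrite e in zy; apply: (ps_psibar_monotonic ps _ _ zy); last by rewrite subr_ge0.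
split => //=; apply: (lt_le_trans (rf_sstar rf)); rewrite lee_fin /tL.
have := rf_s_ge rf 0%N; have : 0 <= k%:R * c by rewrite mulr_ge0// ltW.
by move: c0 l0; lra.
Qed.

Lemma hausdorff_dim_Bad_ge :
  (lower_dim_on mu (Bad X psibar Res s (2 * c + l))
     - (`|ln tau| / (sigma * c))%:E
   <= hausdorff_dim (Bad X psibar Res s (2 * c + l)))%E.
Proof.
have [csigma0 sigma0 diam_le] := sig; have [tau0 _] := ctau.
set B := Bad _ _ _ _ _; set b := _ / _.
have sc : 0 < sigma * c by rewrite mulr_gt0.
have [x0 Xx0] := ps_X_neq0 ps.
have valid0 : valid 0 x0.
  split; last by move=> i /= [].
  split => //=; apply: (lt_le_trans (rf_sstar rf)); rewrite lee_fin /tL mul0r addr0.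
  by have := rf_s_ge rf 0%N; move: l0; lra.
have C0 : 0 < csigma * expR (- (sigma * tL s c l 0)) by rewrite mulr_gt0// expR_gt0.
have q01 : 0 < expR (- (sigma * c)) < 1 by rewrite expR_gt0 expR_lt1 oppr_lt0.
have sub_Bad tau' (ch : nat -> Xbar -> seq Xbar) :
    0 < tau' -> is_measure_tree mu valid Psi ch tau'
      (csigma * expR (- (sigma * tL s c l 0))) (expR (- (sigma * c))) ->
    (forall k x y, valid k x -> y \in ch k x -> Psi k.+1 y `<=` ~` hole k) ->
    \bigcap_k tree_set mu Psi ch x0 k `<=` B.
  move=> tau'0 tree Hhole z Kz; apply: avoid_holes_Bad.
    by have [x [y [_ _ []]]] := tree_setSP tree tau'0 valid0 (Kz 1%N I).
  move=> k; have [x [y [vx yx Pz]]] := tree_setSP tree tau'0 valid0 (Kz k.+1 I).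
  exact: (Hhole k x y).
(* This amounts to [B] being nonempty. Otherwise the limit set is empty, the mass bound holds
   vacuously, and [tree_dimension] would give the empty set dimension at least 1. *)
have dimB0 : (0 <= hausdorff_dim B)%E.
  rewrite /hausdorff_dim; case: ifPn => [/eqP B0|_]; last first.
    by apply: le_ereal_inf_tmp => _ [d [d0 _] <-].
  have tau20 : 0 < tau / 2 by rewrite divr_gt0.
  have [|ch [tree Hhole]] := resonant_tree tau20; first by lra.
  have := sub_Bad _ _ tau20 tree Hhole; rewrite B0 => K0.
  set a := ln (tau / 2) / ln (expR (- (sigma * c))).
  have : ((a + 1 - a)%:E <= hausdorff_dim (set0 : set Xbar))%E.
    apply: (tree_dimension tree tau20 q01 C0 valid0 _ K0); last by move=> z /K0.
    by rewrite ltrDl ltr01.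
  by rewrite /hausdorff_dim eqxx leeNy_eq.
(* If the bound failed, there would be real [r] above the dimension and [d] below the lower
   pointwise dimension with [r + b < d]; the gap [e] is what may be lost in [tau']. *)
rewrite leNgt; apply/negP => /ereal_between[r /andP[dimr]].
rewrite lteBrDr// -EFinD => /ereal_between[d /andP[rbd dlt]].
rewrite lte_fin in rbd.
have r0 : 0 < r by rewrite -lte_fin (le_lt_trans dimB0).
pose e := d - b - r.
have e0 : 0 < e by rewrite /e; lra.
(* Chosen so that [ln tau' / ln q] exceeds [- ln tau / (sigma * c)] by exactly [e]; the tree then
   gives dimension at least [d - b - e = r]. *)
pose tau' := tau * expR (- (sigma * c * e)).
have tau'0 : 0 < tau' by rewrite mulr_gt0// expR_gt0.
have tau'tau : tau' < tau.
  by rewrite gtr_pMr// expR_lt1 oppr_lt0 mulr_gt0.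
have [ch [tree Hhole]] := resonant_tree tau'0 tau'tau.
have KB := sub_Bad _ _ tau'0 tree Hhole.
have aE : ln tau' / ln (expR (- (sigma * c))) = - ln tau / (sigma * c) + e.
  rewrite lnM ?posrE ?expR_gt0// !expRK; field.
  by rewrite !gt_eqF.
have ale : - ln tau / (sigma * c) + e <= d - r.
  have : - ln tau / (sigma * c) <= b.
    by rewrite ler_pM2r ?invr_gt0// -normrN ler_norm.
  by rewrite /e; lra.
have : ((d - ln tau' / ln (expR (- (sigma * c))))%:E <= hausdorff_dim B)%E.
  apply: (tree_dimension tree tau'0 q01 C0 valid0 _ KB).
    by rewrite aE; lra.
  move=> z Kz; apply: lower_pointwise_dim_gt.
  apply: (lt_le_trans dlt); apply: ereal_inf_lbound; exists z => //.
  split; first exact: KB.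
  exact: (tree_set_support tree tau'0 q01 valid0 Kz).
apply/negP; rewrite -ltNge (lt_le_trans dimr)// lee_fin aE.
by lra.
Qed.

End lower_bound.

Theorem theorem2p1 (R : realType) (Xbar : pmetricType R) (X : set Xbar)
    (tstar : \bar R) (psibar : Xbar * R -> set Xbar)
    (Res : nat -> set Xbar) (s : nat -> R) (sstar dstar : R)
    (csigma sigma : R) (c l u : R) :
  is_parameter_space X tstar psibar ->
  is_resonant_family tstar Res s sstar ->
  0 <= dstar ->
  cond_sigma X tstar psibar csigma sigma ->
  0 < c -> dstar <= c -> 0 <= l -> 0 <= u ->
  (forall (mu : {measure set (borel Xbar) -> \bar R}) (tau : R),
      locally_finite mu ->
      cond_mu_pos X tstar psibar mu ->
      cond_tau X tstar psibar Res s dstar c l mu tau ->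
      (lower_dim_on mu (Bad X psibar Res s (2 * c + l))
         - (`|ln tau| / (sigma * c))%:E
       <= hausdorff_dim (Bad X psibar Res s (2 * c + l)))%E)
  /\
  (forall (N : R),
      cond_N X tstar psibar Res s c u N ->
      forall x : Xbar, formal_balls X tstar (x, tU s c u 0) ->
      (hausdorff_dim (Bad X psibar Res s c `&` psi X psibar (x, tU s c u 0))
       <= lne N%:E / (sigma * (c + u))%:E)%E).
Proof.
move=> ps rf _ sig c0 _ l0 u0; split=> [mu tau mulf mu_pos ctau|N cN x fx].
  exact: (hausdorff_dim_Bad_ge ps rf sig c0 l0 mulf mu_pos ctau).
exact: (hausdorff_dim_Bad_le sig cN c0 u0 fx).
Qed.
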